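(* Any complete bipartite graph $G$ is realizable for po-semirings, i.e., there exists a po-semiring $A$ such that $\Gamma(A)\cong G$.
   Context: A commutative semiring is a set $A$ with two distinct elements $0,1$ and two operations $+,\cdot$ such that $(A,+,0)$ and $(A,\cdot,1)$ are commutative monoids, multiplication distributes over addition, and $0\cdot a=0$ for all $a\in A$. A po-semiring is a commutative semiring $(A,+,\cdot,0,1)$ together with a partial order $\le$ on $A$ such that: $x\le y$ implies $x+z\le y+z$; $0\le x$ and $y\le z$ imply $xy\le xz$ (for all $x,y,z\in A$); and $0$ is the least element and $1$ is the largest element of $A$. The zero-divisor graph $\Gamma(A)$ of a po-semiring $A$ is the simple graph whose vertices are the nonzero multiplicative zero-divisors of $A$ (nonzero $x$ with $xy=0$ for some nonzero $y\in A$), distinct vertices $x,y$ being adjacent iff $xy=0$. Graphs are simple and may be finite or infinite; a complete bipartite graph has two nonempty parts of arbitrary (finite or infinite) cardinality. *)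

(* Defs.v *)
From mathcomp Require Import all_boot all_algebra.
From mathcomp Require Import boolp classical_sets.

Set Implicit Arguments.
Unset Strict Implicit.
Unset Printing Implicit Defensive.

Import GRing.Theory.

Local Open Scope classical_set_scope.
Local Open Scope ring_scope.

(* [comNzSemiRingType] includes [1 != 0] and [0 * x = 0].  Its choiceType
   structure and the boolean-valued order are no restriction: classically, every
   type is a choiceType ([gen_eqMixin], [gen_choiceMixin]) and every proposition
   reflects a boolean ([asbool]).
   The order is a field of the record because an HB join of [GRing.ComNzSemiRing]
   with [Order.POrder] is rejected: the library's only join of additive structures
   with orders, [Num.POrderedZmodule], requires opposites. *)
Record po_semiring := POSemiring {
  po_sort :> comNzSemiRingType ;
  po_le : rel po_sort ;
  po_le_refl : reflexive po_le ;
  po_le_anti : antisymmetric po_le ;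
  po_le_trans : transitive po_le ;
  po_leD2r : forall x y z, po_le x y -> po_le (x + z) (y + z) ;
  po_leM2l : forall x y z, po_le 0 x -> po_le y z -> po_le (x * y) (x * z) ;
  po_le0x : forall x, po_le 0 x ;
  po_lex1 : forall x, po_le x 1
}.

Record simple_graph := SimpleGraph {
  vertex :> Type ;
  adj : vertex -> vertex -> Prop ;
  adj_sym : forall u v, adj u v -> adj v u ;
  adj_irrefl : forall u, ~ adj u u
}.

Definition graph_iso (G H : simple_graph) : Prop :=
  exists f : G -> H, bijective f /\ forall u v, adj u v <-> adj (f u) (f v).

Definition complete_bipartite (G : simple_graph) : Prop :=
  exists P Q : set G,
    [/\ P !=set0, Q !=set0, P `&` Q = set0, P `|` Q = setT &
        forall u v, adj u v <-> (P u /\ Q v) \/ (Q u /\ P v)].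

Section ZeroDivisorGraph.
Variable A : po_semiring.

Definition nonzero_zero_divisors : set A :=
  [set x | x <> 0 /\ exists y : A, y <> 0 /\ x * y = 0].

Definition zd_adj (x y : set_type nonzero_zero_divisors) : Prop :=
  x <> y /\ val x * val y = 0.

Fact zd_adj_sym x y : zd_adj x y -> zd_adj y x.
Proof. by move=> [xy xy0]; split; [move/esym | rewrite mulrC]. Qed.

Fact zd_adj_irrefl x : ~ zd_adj x x.
Proof. by case. Qed.

Definition zero_divisor_graph : simple_graph :=
  SimpleGraph zd_adj_sym zd_adj_irrefl.

End ZeroDivisorGraph.

(* Main.v *)
Require Import Defs.
From mathcomp Require Import all_boot all_algebra.
From HB Require Import structures.
From mathcomp Require Import all_order boolp classical_sets functions wochoice.

(** In a po-semiring, [1] being largest forces [x + 1 = 1], hence addition is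
    idempotent and is the join of the order; the natural examples are the
    distributive lattices with a bottom and a top, with join as sum and meet as
    product.  So let [P] and [Q] be the two parts of the graph, choose a total
    order on each, and adjoin to each a new bottom.  In the product of the two
    chains so obtained, a meet of nonbottom elements is the bottom exactly when
    one of them is [(p, 0)] and the other [(0, q)], since in a chain two
    nonbottom elements have a nonbottom meet.  The pairs [(p, 0)] and [(0, q)]
    are thus the zero-divisors, and they form the complete bipartite graph on
    [P] and [Q].

    The product of chains may have no top, so a top is adjoined to serve as [1]
    ([adjoin_top]).  This is harmless for the zero-divisor graph: the new
    element is the unit.  The total orders come from the well-ordering theorem
    ([total_order_on]). *)

Set Implicit Arguments.
Unset Strict Implicit.
Unset Printing Implicit Defensive.

Import Order.TTheory GRing.Theory.

Local Open Scope order_scope.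

(** * A total order on any type *)

(** A copy of [T] on which the order chosen below can be attached even when [T]
    already carries structures of its own. *)
Definition total_order_on (T : Type) : Type := T.

Section TotalOrderOn.
Variable T : Type.

HB.instance Definition _ := gen_eqMixin (total_order_on T).
HB.instance Definition _ := gen_choiceMixin (total_order_on T).

Let le : rel (total_order_on T) :=
  sval (well_ordering_principle (total_order_on T)).

Let le_wo : wo_chain le predT.
Proof. by move=> A _; apply: (svalP (well_ordering_principle _)). Qed.

Let le_total : total le.
Proof. by move=> x y; apply: (wo_chainW le_wo). Qed.

Let le_anti : antisymmetric le.
Proof. by move=> x y; apply: (wo_chain_antisymmetric le_wo). Qed.

(** By totality only a cycle [x <= y <= z <= x] has to be considered: there the
    least of the three elements is also above its predecessor, hence equal to
    it. *)
Let le_trans : transitive le.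
Proof.
move=> y x z xy yz.
have [//|zx] := orP (le_total x z).
have [|m [[ms minm] _]] :=
    svalP (well_ordering_principle (total_order_on T)) (mem [:: x; y; z]).
  by exists x; apply: mem_head.
have mx : le m x by apply: minm; rewrite !inE eqxx.
have my : le m y by apply: minm; rewrite !inE eqxx orbT.
have mz : le m z by apply: minm; rewrite !inE eqxx !orbT.
move: ms; rewrite !inE => /or3P[] /eqP me; subst m => //.
- by rewrite (@le_anti x y) // xy.
- by rewrite -(@le_anti y z) // yz.
Qed.

HB.instance Definition _ := Order.Le_isPOrder.Build (Order.Disp tt tt)
  (total_order_on T) (fun x => wo_chain_reflexive le_wo (erefl : x \in predT))
  le_anti le_trans.
HB.instance Definition _ := Order.POrder_isTotal.Build (Order.Disp tt tt)
  (total_order_on T) le_total.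

End TotalOrderOn.

(** * Adjoining a bottom to a chain *)

Definition adjoin_bot (T : Type) : Type := option T.

Section AdjoinBot.
Context {d : Order.disp_t} {T : orderType d}.
Implicit Types x y z : adjoin_bot T.

HB.instance Definition _ := Choice.on (adjoin_bot T).

Let le x y : bool :=
  match x, y with
  | None, _ => true
  | Some _, None => false
  | Some a, Some b => a <= b
  end.

Let le_refl : reflexive le. Proof. by case=> /=. Qed.

Let le_anti : antisymmetric le.
Proof. by move=> [a|] [b|] //= /le_anti->. Qed.

Let le_trans : transitive le.
Proof. by move=> [b|] [a|] [c|] //=; apply: le_trans. Qed.

Let le_total : total le.
Proof. by move=> [a|] [b|] //=; apply: le_total. Qed.

HB.instance Definition _ :=
  Order.Le_isPOrder.Build d (adjoin_bot T) le_refl le_anti le_trans.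
HB.instance Definition _ := Order.POrder_isTotal.Build d (adjoin_bot T) le_total.
HB.instance Definition _ :=
  Order.hasBottom.Build d (adjoin_bot T) (fun=> erefl : le None _).

End AdjoinBot.

Lemma chain_meet_eq0 {d : Order.disp_t} {T : bOrderType d} (x y : T) :
  (x `&` y == \bot) = (x == \bot) || (y == \bot).
Proof.
case: (leP x y) => [xy|/ltW yx].
  by apply/idP/orP => [->|[//|/eqP y0]]; [left | rewrite -lex0 -y0].
by apply/idP/orP => [->|[/eqP x0|//]]; [right | rewrite -lex0 -x0].
Qed.

(** * The semiring of a distributive lattice with a new top *)

(** Here [None] is the new top, whereas in [adjoin_bot] it is the new bottom. *)
Definition adjoin_top (L : Type) : Type := option L.

Section AdjoinTop.
Context {d : Order.disp_t} {L : bDistrLatticeType d}.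
Implicit Types x y z : adjoin_top L.

HB.instance Definition _ := Choice.on (adjoin_top L).

Definition adjoin_top_add x y : adjoin_top L :=
  match x, y with
  | Some a, Some b => Some (a `|` b)
  | _, _ => None
  end.

Definition adjoin_top_mul x y : adjoin_top L :=
  match x, y with
  | None, _ => y
  | _, None => x
  | Some a, Some b => Some (a `&` b)
  end.

Let addA : associative adjoin_top_add.
Proof. move=> [a|] [b|] [c|] //=. by rewrite joinA. Qed.

Let addC : commutative adjoin_top_add.
Proof. by move=> [a|] [b|] //=; rewrite joinC. Qed.

Let add0 : left_id (Some \bot : adjoin_top L) adjoin_top_add.
Proof. by move=> [a|] //=; rewrite join0x. Qed.

Let mulA : associative adjoin_top_mul.
Proof. by move=> [a|] [b|] [c|] //=; rewrite meetA. Qed.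

Let mulC : commutative adjoin_top_mul.
Proof. by move=> [a|] [b|] //=; rewrite meetC. Qed.

Let mul1 : left_id (None : adjoin_top L) adjoin_top_mul. Proof. by case. Qed.

Let mulDl : left_distributive adjoin_top_mul adjoin_top_add.
Proof.
move=> [a|] [b|] [c|] //=.
- by rewrite meetUl.
- by rewrite join_r ?leIr.
- by rewrite join_l ?leIr.
- by rewrite joinxx.
Qed.

Let mul0 : left_zero (Some \bot : adjoin_top L) adjoin_top_mul.
Proof. by move=> [a|] //=; rewrite meet0x. Qed.

HB.instance Definition _ :=
  GRing.isNmodule.Build (adjoin_top L) addA addC add0.
HB.instance Definition _ :=
  GRing.Nmodule_isComNzSemiRing.Build (adjoin_top L) mulA mulC mul1 mulDl mul0
    (erefl : None != Some \bot).

Definition adjoin_top_le x y : bool :=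
  match x, y with
  | _, None => true
  | None, Some _ => false
  | Some a, Some b => a <= b
  end.

Let le_refl : reflexive adjoin_top_le. Proof. by case=> /=. Qed.

Let le_anti : antisymmetric adjoin_top_le.
Proof. by move=> [a|] [b|] //= /le_anti->. Qed.

Let le_trans : transitive adjoin_top_le.
Proof. by move=> [b|] [a|] [c|] //=; apply: le_trans. Qed.

Let leD x y z : adjoin_top_le x y -> adjoin_top_le (x + z)%R (y + z)%R.
Proof. by case: x y z => [a|] [b|] [c|] //= ab; apply: leU2. Qed.

Let leM x y z : adjoin_top_le (0 : adjoin_top L)%R x ->
  adjoin_top_le y z -> adjoin_top_le (x * y)%R (x * z)%R.
Proof.
by case: x y z => [a|] [b|] [c|] //= _ bc; [apply: leI2 | apply: leIl].
Qed.

Let le0 x : adjoin_top_le (0 : adjoin_top L)%R x.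
Proof. by case: x => [a|] //=; apply: le0x. Qed.

Let le1 x : adjoin_top_le x (1 : adjoin_top L)%R.
Proof. by case: x. Qed.

Definition adjoin_top_semiring : po_semiring :=
  POSemiring le_refl le_anti le_trans leD leM le0 le1.

End AdjoinTop.

(** * Zero-divisors of a product of two chains *)

Section TwoChains.
Variables P Q : Type.

Definition chain_on (T : Type) : Type := adjoin_bot (total_order_on T).
HB.instance Definition _ T := Order.BTotal.on (chain_on T).

Definition two_chains_semiring : po_semiring :=
  @adjoin_top_semiring _ (chain_on P *p chain_on Q)%type.

Definition in_left (p : P) : two_chains_semiring :=
  Some (Some p : chain_on P, None : chain_on Q).
Definition in_right (q : Q) : two_chains_semiring :=
  Some (None : chain_on P, Some q : chain_on Q).

Local Open Scope ring_scope.

(** As in a chain a meet is the bottom only if one of its arguments is, [x * y = 0]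
    forces [x] or [y] to vanish in each coordinate; since both are nonzero, they
    vanish in opposite coordinates. *)
Lemma mul_two_chains_eq0 (x y : two_chains_semiring) :
    x <> 0 -> y <> 0 -> x * y = 0 ->
  exists p q,
    (x = in_left p /\ y = in_right q) \/ (x = in_right q /\ y = in_left p).
Proof.
case: x y => [[a b]|] [[c d]|] // x0 y0 [].
move=> /eqP + /eqP; rewrite !chain_meet_eq0.
case: a b c d x0 y0 => [p|] [q|] [p'|] [q'|] // _ _ _ _.
- by exists p, q'; left.
- by exists p', q; right.
Qed.

Lemma nonzero_zero_divisor_two_chains (x : two_chains_semiring) :
  nonzero_zero_divisors x ->
  (exists p, x = in_left p) \/ (exists q, x = in_right q).
Proof.
case=> x0 [y [y0 /(mul_two_chains_eq0 x0 y0)]].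
by case=> p [q [[-> _]|[-> _]]]; [left; exists p | right; exists q].
Qed.

End TwoChains.

(** * Realizing a complete bipartite graph *)

Theorem lemma2p1 (G : simple_graph) (hG : complete_bipartite G) :
  exists A : po_semiring, graph_iso (zero_divisor_graph A) G.
Proof.
case: hG => P [Q [[p0 Pp0] [q0 Qq0] PQ0 PQT adjE]].
have PQ v : P v -> Q v -> False.
  by move=> Pv Qv; have : (P `&` Q)%classic v by []; rewrite PQ0.
have val_neq (p : set_type P) (q : set_type Q) : val p <> val q.
  move=> pq; apply: (PQ (val p)); first exact: set_valP.
  by rewrite pq; exact: set_valP.
pose A := two_chains_semiring (set_type P) (set_type Q).
exists A.
(* Only the values at the zero-divisors matter; [p0] is a default for [0] and
   [1]. *)
pose vertex_of (x : A) : G :=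
  match x with
  | Some (Some p, _) => val (p : set_type P)
  | Some (None, Some q) => val (q : set_type Q)
  | _ => p0
  end.
(* Each part is nonempty, and its elements annihilate those of the other part:
   every vertex of the graph thus gives a zero-divisor. *)
have left_vertex v (Pv : P v) :
    nonzero_zero_divisors
      (in_left (set_type Q) (SigSub (mem_set Pv)) : A).
  by split=> //; exists (in_right (set_type P) (SigSub (mem_set Qq0))).
have right_vertex v (Qv : Q v) :
    nonzero_zero_divisors
      (in_right (set_type P) (SigSub (mem_set Qv)) : A).
  by split=> //; exists (in_left (set_type Q) (SigSub (mem_set Pp0))).
exists (fun x : zero_divisor_graph A => vertex_of (val x)); split.
  rewrite -setTT_bijective; split=> //.
    move=> x y _ _; move: (set_valP x) (set_valP y) => zx zy xy.
    apply: val_inj; move: xy.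
    case/nonzero_zero_divisor_two_chains: zx => -[u ->];
    case/nonzero_zero_divisor_two_chains: zy => -[w ->] /= uw.
    - by congr in_left; apply: val_inj.
    - by case: (val_neq _ _ uw).
    - by case: (val_neq _ _ (esym uw)).
    - by congr in_right; apply: val_inj.
  move=> v _; have : (P `|` Q)%classic v by rewrite PQT.
  case=> [Pv|Qv].
  - by exists (SigSub (mem_set (left_vertex v Pv))).
  - by exists (SigSub (mem_set (right_vertex v Qv))).
move=> x y; rewrite adjE; split.
  case=> _ xy0.
  have [x0 _] := set_valP x; have [y0 _] := set_valP y.
  have [p [q [[-> ->]|[-> ->]]]] := mul_two_chains_eq0 x0 y0 xy0; [left|right].
  - by split; apply: set_valP.
  - by split; apply: set_valP.
move=> xy.
suff xy0 : (val x * val y = 0)%R.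
  split=> // exy; move: xy; rewrite exy.
  by case=> -[? ?]; apply: PQ; eassumption.
move: xy.
have [[p ->]|[q ->]] := nonzero_zero_divisor_two_chains (set_valP x);
have [[p' ->]|[q' ->]] := nonzero_zero_divisor_two_chains (set_valP y) => /=.
- have Pp := set_valP p; have Pp' := set_valP p'.
  by case=> -[u w]; case: (PQ _ Pp'); [|case: (PQ _ Pp)].
- by [].
- by rewrite mulrC.
- have Qq := set_valP q; have Qq' := set_valP q'.
  by case=> -[u w]; [case: (PQ _ u)|case: (PQ _ w)].
Qed.
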